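(* Let $X$ and $Y$ be Banach spaces and let $A : X \to Y$ be a bounded linear operator. The problem $Ax = y$ is \begin{enumerate} \item (HaWP) if and only if there exists $B \in L(Y,X)$ with $BA = \mathrm{Id}_X$ and $AB = \mathrm{Id}_Y$; \item (HSWP) if and only if there exists $B \in L(\mathcal{R}(A),X)$ with $BA = \mathrm{Id}_X$; \item (NVWP) if and only if there exists $B \in L(Y,X)$ with $ABA = A$; \item (WP) if and only if there exists $B \in L(\mathcal{R}(A),X)$ with $ABA = A$; \item ($\mathcal{R}$-WP) if and only if there exists a (possibly nonlinear) continuous map $B : \overline{\mathcal{R}(A)} \to X$ with $A\, B \circ A = A$ (that is, $A(B(Ax)) = Ax$ for all $x \in X$); or, equivalently, if and only if the operator $\tilde{A} : X/\mathcal{N}(A) \to \mathcal{R}(A)$ has a bounded linear inverse. \end{enumerate}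
   Context: $\mathcal{R}(A) \subseteq Y$ denotes the range and $\mathcal{N}(A) \subseteq X$ the null-space of $A$; $\mathcal{R}(A)$ carries the norm of $Y$, and $\overline{\mathcal{R}(A)}$ is its closure in $Y$. $L(V,W)$ denotes the set of bounded linear maps from the normed space $V$ to the normed space $W$. A closed subspace $N$ of a Banach space $X$ is called complemented in $X$ if there is a closed subspace $U$ of $X$ with $X = N \oplus U$ (direct sum). The operator $\tilde{A} : X/\mathcal{N}(A) \to \mathcal{R}(A)$ is defined by $\tilde{A}\langle x\rangle = Ax$, where $\langle x \rangle$ is the equivalence class of $x$ in the quotient space $X/\mathcal{N}(A)$. The operator equation $Ax = y$ is called: - (HaWP) (well-posed in the sense of Hadamard) iff $\mathcal{R}(A) = Y$ and $\mathcal{N}(A) = \{0\}$; - (HSWP) (well-posed in the sense of Hofmann-Scherzer) iff $\mathcal{R}(A)$ is closed and $\mathcal{N}(A) = \{0\}$; - (NVWP) (well-posed in the sense of Nashed-Votruba) iff $\mathcal{R}(A)$ is closed, $\mathcal{N}(A)$ is complemented in $X$, and $\mathcal{R}(A)$ is complemented in $Y$; - (WP) (well-posed) iff $\mathcal{R}(A)$ is closed and $\mathcal{N}(A)$ is complemented in $X$; - ($\mathcal{R}$-WP) (range-well-posed) iff $\mathcal{R}(A)$ is closed. *)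

(* Defs.v *)
From HB Require Import structures.
From mathcomp Require Import all_boot all_order all_algebra.
From mathcomp Require Import generic_quotient ring_quotient.
From mathcomp Require Import all_classical all_reals all_analysis.
From mathcomp Require Import complex.

Set Implicit Arguments.
Unset Strict Implicit.
Unset Printing Implicit Defensive.

Import Order.TTheory GRing.Theory Num.Theory.
Import numFieldNormedType.Exports.

Local Open Scope classical_set_scope.
Local Open Scope ring_scope.
Local Open Scope quotient_scope.

(* Banach spaces are real or complex: they are completeNormedModTypes over
   scalar_field R s. *)
Variant scalar_kind := RealScalars | ComplexScalars.

Definition scalar_field (R : realType) (s : scalar_kind) : numFieldType :=
  match s with
  | RealScalars => R
  | ComplexScalars => R[i]
  end.

(* In MathComp a norm over R[i] takes its values in R[i] (in its real
   half-line), hence the need to go back and forth between R and the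
   scalars. *)
Definition scalar_of_real (R : realType) (s : scalar_kind) :
    R -> scalar_field R s :=
  match s return R -> scalar_field R s with
  | RealScalars => fun r => r
  | ComplexScalars => fun r => (r%:C)%C
  end.

Definition real_of_scalar (R : realType) (s : scalar_kind) :
    scalar_field R s -> R :=
  match s return scalar_field R s -> R with
  | RealScalars => fun r => r
  | ComplexScalars => fun z => complex.Re z
  end.

Section scalars.
Variables (R : realType) (s : scalar_kind).
Local Notation K := (scalar_field R s).
Local Notation ofR := (@scalar_of_real R s).
Local Notation toR := (@real_of_scalar R s).

Lemma scalar_of_real_le (a b : R) : (ofR a <= ofR b) = (a <= b).
Proof. by case: s => //=; rewrite lecR. Qed.

Lemma scalar_of_real_lt (a b : R) : (ofR a < ofR b) = (a < b).
Proof. by case: s => //=; rewrite ltcR. Qed.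

Lemma scalar_of_realD (a b : R) : ofR (a + b) = ofR a + ofR b.
Proof. by case: s => //=; rewrite rmorphD. Qed.

Lemma scalar_of_realM (a b : R) : ofR (a * b) = ofR a * ofR b.
Proof. by case: s => //=; rewrite rmorphM. Qed.

Lemma scalar_of_real0 : ofR 0 = 0.
Proof. by case: s. Qed.

Lemma scalar_of_real_inj : injective ofR.
Proof. by move=> a b ab; apply/le_anti; rewrite -!scalar_of_real_le ab lexx. Qed.

Lemma real_of_scalarK (k : K) : 0 <= k -> ofR (toR k) = k.
Proof.
by case: s k => //= -[a b]; rewrite lecE /= => /andP[/eqP-> _].
Qed.

End scalars.

HB.mixin Record isBoundedMap (K : numFieldType) (V W : normedModType K)
    (f : V -> W) := {
  bounded_map_subproof : exists M : K, forall x : V, `|f x| <= M * `|x|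
}.

(* The type of K-linear maps which are bounded, written 'L(V, W). *)
HB.structure Definition BoundedLinear (K : numFieldType)
    (V W : normedModType K) :=
  {f of @GRing.Linear K V W *:%R f & isBoundedMap K V W f}.

Notation "''L' ( V , W )" := (BoundedLinear.type V W)
  (at level 8, format "''L' ( V ,  W )") : type_scope.

Section range.
Variables (K : numFieldType) (X Y : normedModType K) (A : 'L(X, Y)).

(* N(A); the range of A as a subset of Y is the library's [range A]. *)
Definition null_space : set X := A @^-1` [set 0].

Definition range_pred : {pred Y} := fun y => y \in range A.

Lemma range_pred_submod_closed : submod_closed range_pred.
Proof.
split=> [|a u v]; first by apply/mem_set; exists 0 => //; rewrite linear0.
move=> /set_mem[x _ <-] /set_mem[y _ <-]; apply/mem_set.
by exists (a *: x + y) => //; rewrite linearP.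
Qed.

HB.instance Definition _ :=
  GRing.isSubmodClosed.Build K Y range_pred range_pred_submod_closed.

(* The range of A as a normed space in its own right, with the norm of Y. *)
Definition range_space := {y : Y | range_pred y}.

HB.instance Definition _ := SubChoice.on range_space.
HB.instance Definition _ := [SubChoice_isSubLmodule of range_space by <:].

Definition range_norm (y : range_space) : K := `|val y|.

Lemma range_normD (x y : range_space) :
  range_norm (x + y) <= range_norm x + range_norm y.
Proof. exact: ler_normD. Qed.

Lemma range_normZ (l : K) (x : range_space) :
  range_norm (l *: x) = `|l| * range_norm x.
Proof. exact: normrZ. Qed.

Lemma range_norm_eq0 (x : range_space) : range_norm x = 0 -> x = 0.
Proof. by move=> /normr0_eq0 x0; apply/val_inj; rewrite x0. Qed.

HB.instance Definition _ := Lmodule_isNormed.Build K range_space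
  range_normD range_normZ range_norm_eq0.

Lemma mem_range_pred (x : X) : range_pred (A x).
Proof. by apply/mem_set; exists x. Qed.

(* A seen as a map onto its range. *)
Definition corestr (x : X) : range_space := Sub (A x) (mem_range_pred x).

End range.

Section quotient.
Variables (R : realType) (s : scalar_kind).
Local Notation K := (scalar_field R s).
Variables (X Y : normedModType K) (A : 'L(X, Y)).

Definition null_pred : {pred X} := fun x => x \in null_space A.

Lemma null_predE (x : X) : (x \in null_pred) = (A x == 0).
Proof. by apply/idP/eqP => [/set_mem//|Ax0]; apply/mem_set. Qed.

Lemma null_pred_submod_closed : submod_closed null_pred.
Proof.
split=> [|a u v]; first by rewrite null_predE linear0.
by rewrite !null_predE linearP /= => /eqP-> /eqP->; rewrite scaler0 addr0.
Qed.

HB.instance Definition _ :=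
  GRing.isSubmodClosed.Build K X null_pred null_pred_submod_closed.

(* X / N(A), whose elements are the classes [coset x]; it is a normed space
   for the quotient norm quot_norm below. *)
Definition quot_null := Quotient.quot (null_pred : zmodClosed X).

HB.instance Definition _ := GRing.Zmodule.on quot_null.
HB.instance Definition _ := EqQuotient.on quot_null.

Definition coset (x : X) : quot_null := \pi_quot_null x.

Lemma coset_eqP (x y : X) : coset x = coset y <-> A x = A y.
Proof.
split=> [/eqP|Axy]; last apply/eqP; rewrite -Quotient.idealrBE null_predE.
  by rewrite linearB /= subr_eq0 => /eqP.
by rewrite linearB /= subr_eq0 Axy.
Qed.

Lemma cosetD : {morph coset : x y / x + y}.
Proof. by move=> x y; rewrite /coset piE. Qed.

Lemma coset0 : coset 0 = 0.
Proof. by apply: (addIr (coset 0)); rewrite -cosetD addr0 add0r. Qed.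

Definition quot_scale (a : K) (q : quot_null) : quot_null := coset (a *: repr q).

Lemma cosetK : cancel (repr : quot_null -> X) coset.
Proof. exact: reprK. Qed.

Lemma quot_scaleE (a : K) (x : X) : quot_scale a (coset x) = coset (a *: x).
Proof.
by apply/coset_eqP; rewrite !linearZ; congr (_ *: _); apply/coset_eqP/cosetK.
Qed.

Let quot_scaleA a b q : quot_scale a (quot_scale b q) = quot_scale (a * b) q.
Proof. by rewrite -[q]cosetK !quot_scaleE scalerA. Qed.

Let quot_scale1 : left_id 1 quot_scale.
Proof. by move=> q; rewrite -[q]cosetK quot_scaleE scale1r. Qed.

Let quot_scaleDr : right_distributive quot_scale +%R.
Proof.
by move=> a p q; rewrite -[p]cosetK -[q]cosetK !(quot_scaleE, =^~ cosetD) scalerDr.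
Qed.

Let quot_scaleDl q : {morph quot_scale^~ q : a b / a + b}.
Proof. by move=> a b; rewrite -[q]cosetK !quot_scaleE scalerDl cosetD. Qed.

HB.instance Definition _ := GRing.Zmodule_isLmodule.Build K quot_null
  quot_scaleA quot_scale1 quot_scaleDr quot_scaleDl.

Lemma cosetZ (a : K) (x : X) : coset (a *: x) = a *: coset x.
Proof. by rewrite -quot_scaleE. Qed.

Local Notation ofR := (@scalar_of_real R s).
Local Notation toR := (@real_of_scalar R s).

(* The norm of a class is the infimum of the norms of its elements, taken in
   R because R[i] has no infimum operator. *)
Definition class_norms (q : quot_null) : set R :=
  [set toR `|x| | x in [set x | coset x = q]].

Definition quot_norm (q : quot_null) : K := ofR (inf (class_norms q)).

Let nrm (x : X) : R := toR `|x|.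

Let nrmE x : ofR (nrm x) = `|x|.
Proof. exact: real_of_scalarK. Qed.

Let nrm_ge0 x : 0 <= nrm x.
Proof. by rewrite -(scalar_of_real_le s) nrmE scalar_of_real0. Qed.

Let class_norms_lb q : lbound (class_norms q) 0.
Proof. by move=> _ [x _ <-]; exact: nrm_ge0. Qed.

Let class_norms_has_inf q : has_inf (class_norms q).
Proof.
split; last by exists 0; exact: class_norms_lb.
by exists (nrm (repr q)); exists (repr q) => //=; exact: cosetK.
Qed.

Let inf_le q x : coset x = q -> inf (class_norms q) <= nrm x.
Proof.
by move=> xq; apply: ge_inf; [case: (class_norms_has_inf q)|exists x].
Qed.

Let le_inf q r : (forall x, coset x = q -> r <= nrm x) ->
  r <= inf (class_norms q).
Proof.
move=> H; apply: lb_le_inf; first by case: (class_norms_has_inf q).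
by move=> _ [x xq <-]; exact: H.
Qed.

Let quot_norm_ge0 q : 0 <= quot_norm q.
Proof.
by rewrite -(scalar_of_real0 R s) scalar_of_real_le; apply: le_inf.
Qed.

Lemma quot_normD (p q : quot_null) :
  quot_norm (p + q) <= quot_norm p + quot_norm q.
Proof.
rewrite -scalar_of_realD scalar_of_real_le -lerBlDr.
apply: le_inf => x xp; rewrite lerBlDr [leRHS]addrC -lerBlDr.
apply: le_inf => y yq; rewrite lerBlDr [leRHS]addrC.
have /inf_le/le_trans -> // : coset (x + y) = p + q by rewrite cosetD xp yq.
by rewrite -(scalar_of_real_le s) scalar_of_realD !nrmE ler_normD.
Qed.

Let quot_norm0 : quot_norm 0 = 0.
Proof.
apply/le_anti; rewrite quot_norm_ge0 andbT -[leRHS](scalar_of_real0 R s).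
rewrite scalar_of_real_le (le_trans (inf_le coset0))//.
by rewrite -(scalar_of_real_le s) nrmE normr0 scalar_of_real0.
Qed.

Let quot_normZ_le (l : K) (q : quot_null) : quot_norm (l *: q) <= `|l| * quot_norm q.
Proof.
have [->|l0] := eqVneq l 0; first by rewrite scale0r quot_norm0 normr0 mul0r.
have l_gt0 : 0 < toR `|l|.
  by rewrite -(scalar_of_real_lt s) real_of_scalarK// scalar_of_real0 normr_gt0.
rewrite -{1}(@real_of_scalarK R s `|l|)// -scalar_of_realM scalar_of_real_le.
rewrite -ler_pdivrMl//; apply: le_inf => x xq; rewrite ler_pdivrMl//.
have /inf_le/le_trans -> // : coset (l *: x) = l *: q by rewrite cosetZ xq.
by rewrite -(scalar_of_real_le s) scalar_of_realM !nrmE normrZ real_of_scalarK.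
Qed.

Lemma quot_normZ (l : K) (q : quot_null) : quot_norm (l *: q) = `|l| * quot_norm q.
Proof.
have [->|l0] := eqVneq l 0; first by rewrite scale0r quot_norm0 normr0 mul0r.
apply/le_anti; rewrite quot_normZ_le /= -ler_pdivlMl ?normr_gt0//.
by rewrite -normfV (le_trans _ (quot_normZ_le _ _))// scalerK.
Qed.

Lemma quot_norm_eq0 (q : quot_null) : quot_norm q = 0 -> q = 0.
Proof.
rewrite -(scalar_of_real0 R s) => /scalar_of_real_inj q0.
have [M AM] : exists M : K, forall x, `|A x| <= M * `|x|.
  exact: bounded_map_subproof.
rewrite -[q]cosetK -[RHS]cosetK; apply/coset_eqP.
have -> : A (repr (0 : quot_null)) = 0.
  by rewrite -[RHS](linear0 A); apply/coset_eqP; rewrite cosetK coset0.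
set y := A _; pose m := toR `|M|.
have m1_gt0 : 0 < m + 1.
  rewrite ltr_wpDl// -(scalar_of_real_le s) real_of_scalarK//.
  by rewrite scalar_of_real0.
have y0 : toR `|y| <= 0.
  rewrite -(mulr0 (m + 1)) -ler_pdivrMl// -q0; apply: le_inf => x xq.
  rewrite ler_pdivrMl// -(scalar_of_real_le s) scalar_of_realM nrmE.
  rewrite real_of_scalarK//.
  have -> : y = A x by apply/coset_eqP; rewrite cosetK.
  have := AM x; rewrite -(ger0_norm (le_trans _ (AM x)))// normrM normr_id.
  move=> /le_trans -> //; rewrite ler_wpM2r// scalar_of_realD real_of_scalarK//.
  by rewrite lerDl -(scalar_of_real0 R s) scalar_of_real_le.
apply/normr0_eq0/le_anti; rewrite normr_ge0 andbT.
by rewrite -(@real_of_scalarK R s `|y|)// -(scalar_of_real0 R s) scalar_of_real_le.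
Qed.

HB.instance Definition _ := Lmodule_isNormed.Build K quot_null
  quot_normD quot_normZ quot_norm_eq0.

(* By Atilde_coset below, this does not depend on the representative. *)
Definition Atilde (q : quot_null) : range_space A := corestr A (repr q).

Lemma Atilde_coset (x : X) : Atilde (coset x) = corestr A x.
Proof. by apply/val_inj/coset_eqP; rewrite cosetK. Qed.

End quotient.

Arguments coset {R s X Y} A x.
Arguments Atilde {R s X Y} A q.

Section well_posedness.
Variable K : numFieldType.

Definition closed_subspace (V : normedModType K) (U : set V) :=
  submod_closed (fun v => v \in U) /\ closed U.

(* Meant for a closed subspace N. *)
Definition complemented (V : normedModType K) (N : set V) :=
  exists U : set V, [/\ closed_subspace U,
    forall v, exists n u, [/\ N n, U u & v = n + u] & N `&` U = [set 0]].

Variables (X Y : normedModType K) (A : 'L(X, Y)).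

Definition HaWP := range A = [set: Y] /\ null_space A = [set 0].

Definition HSWP := closed (range A) /\ null_space A = [set 0].

Definition NVWP :=
  [/\ closed (range A), complemented (null_space A) & complemented (range A)].

Definition WP := closed (range A) /\ complemented (null_space A).

Definition RWP := closed (range A).

End well_posedness.

(* Main.v *)
Require Import Defs.
From HB Require Import structures.
From mathcomp Require Import all_boot all_order all_algebra.
From mathcomp Require Import all_classical all_reals all_analysis.
From mathcomp Require Import wochoice ring lra.

(** Every equivalence rests on one result, [continuous_right_inverse]: a bounded
operator [T] that maps a closed subspace [D] of a Banach space onto a Banach
space has a right inverse [G] with values in [D] which is continuous and
satisfies [`|G z| <= C * `|z|].  The bound is the open mapping theorem, the
continuity is the theorem of Bartle and Graves.  They are obtained together.
Baire's theorem provides, for each [z], an approximate solution of [T x = z]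
whose size is controlled ([almost_open]).  The bounded approximate solutions
form convex sets, and each of them remains an approximate solution for the
points near [z]; hence they can be chosen continuously ([convex_selection], the
paracompactness of metric spaces in disguise).  Iterating on the residual turns
a continuous approximate right inverse into an exact one
([successive_approximation]).

If [T] is injective on [D], then [G] is unique, hence linear, and it is bounded.
This yields the bounded linear [B]: with [D] the whole space when the null space
is trivial; with [D] a complement of the null space in the well-posed case; and
with the product of the complements [U] of the null space and [V] of the range,
and [T (u, v) = A u + v], in the sense of Nashed and Votruba.  Without
injectivity, [G] is the nonlinear continuous map of range-well-posedness, and
its composition with the canonical projection onto the quotient by the null
space inverts the quotient map.

Conversely, a one-sided inverse makes the range closed.  If the inverse is
bounded on the range only, each point of the range has a preimage of comparable
size and the iteration on the residual shows that the range is closed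
([closed_range_of_bound]); if it is continuous on the closure of the range,
[A B] and the identity agree on that closure.  Complements are the kernels and
the images of the bounded projections [B A] and [A B]
([projection_complement]).

The analysis is carried out over the reals, where norms can be compared and
Urysohn functions exist; a complex space is handled through its restriction of
scalars [realify]. *)

Set Implicit Arguments.
Unset Strict Implicit.
Unset Printing Implicit Defensive.

Import Order.TTheory GRing.Theory Num.Theory.
Import numFieldNormedType.Exports.

Local Open Scope classical_set_scope.
Local Open Scope ring_scope.

(** * Complex spaces as real spaces *)

(** Restriction of scalars. [realify V] is [V] itself, with the scalars cut down
to the reals and the norm read as a real number.  It inherits the uniform
structure of [V] instead of getting one generated by the new norm, so that
continuity, closedness and completeness in [realify V] and in [V] are the same
statements up to conversion and need no transfer lemma. *)
Definition realify (R : realType) (s : scalar_kind)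
  (V : normedModType (scalar_field R s)) : Type := V.

Section realify.
Variables (R : realType) (s : scalar_kind).
Local Notation K := (scalar_field R s).
Local Notation ofR := (@scalar_of_real R s).
Local Notation toR := (@real_of_scalar R s).

Lemma scalar_of_real1 : ofR 1 = 1.
Proof. by case: s. Qed.

Lemma norm_scalar_of_real (a : R) : `|ofR a| = ofR `|a|.
Proof.
have ofN b : ofR (- b) = - ofR b.
  by apply/eqP; rewrite -addr_eq0 -scalar_of_realD addNr scalar_of_real0.
case: (lerP 0 a) => a0.
  by rewrite !ger0_norm// -(scalar_of_real0 R s) scalar_of_real_le.
rewrite (ltr0_norm a0) ofN ltr0_norm//.
by rewrite -(scalar_of_real0 R s) scalar_of_real_lt.
Qed.

Variable V : normedModType K.

HB.instance Definition _ := Choice.on (realify V).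
HB.instance Definition _ := GRing.Zmodule.on (realify V).
HB.instance Definition _ := Uniform.on (realify V).
HB.instance Definition _ := Pointed.on (realify V).

Let V' := realify V.

Let rscale (a : R) (x : V') : V' := ofR a *: (x : V).
Let rscaleA a b v : rscale a (rscale b v) = rscale (a * b) v.
Proof. by rewrite /rscale scalerA scalar_of_realM. Qed.
Let rscale1 : left_id 1 rscale.
Proof. by move=> v; rewrite /rscale scalar_of_real1 scale1r. Qed.
Let rscaleDr : right_distributive rscale +%R.
Proof. by move=> a u v; rewrite /rscale scalerDr. Qed.
Let rscaleDl v : {morph rscale^~ v : a b / a + b}.
Proof. by move=> a b; rewrite /rscale scalar_of_realD scalerDl. Qed.

HB.instance Definition _ := GRing.Zmodule_isLmodule.Build R (realify V)
  rscaleA rscale1 rscaleDr rscaleDl.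

Let rnorm (x : V') : R := toR `|x : V|.
Let rnormE x : ofR (rnorm x) = `|x : V|.
Proof. exact: real_of_scalarK. Qed.
Let rnormD x y : rnorm (x + y) <= rnorm x + rnorm y.
Proof.
by rewrite -(scalar_of_real_le s) scalar_of_realD !rnormE; exact: ler_normD.
Qed.
Let rnorm0 x : rnorm x = 0 -> x = 0.
Proof.
by move=> /(congr1 ofR); rewrite rnormE scalar_of_real0 => /normr0_eq0.
Qed.
Let rnormMn x n : rnorm (x *+ n) = rnorm x *+ n.
Proof.
apply: (@scalar_of_real_inj R s); rewrite rnormE.
have -> : `|(x *+ n : V)| = `|x : V| *+ n by exact: normrMn.
elim: n => [|n IH]; first by rewrite !mulr0n scalar_of_real0.
by rewrite !mulrS scalar_of_realD rnormE IH.
Qed.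
Let rnormN x : rnorm (- x) = rnorm x.
Proof. by rewrite /rnorm; congr (toR _); exact: normrN. Qed.

HB.instance Definition _ := Num.Zmodule_isNormed.Build R (realify V)
  rnormD rnorm0 rnormMn rnormN.

Let rball (x : V') (e : R) := [set y | rnorm (x - y) < e].
Let rballE x e : rball x e = ball (x : V) (ofR e).
Proof.
rewrite -ball_normE; apply/seteqP; split=> y;
  by rewrite /= /rball/= -(scalar_of_real_lt s) rnormE.
Qed.
Let rball_center x e : 0 < e -> rball x e x.
Proof.
move=> e0; rewrite rballE; apply: ballxx.
by rewrite -(scalar_of_real0 R s) scalar_of_real_lt.
Qed.
Let rball_sym x y e : rball x e y -> rball y e x.
Proof. by rewrite !rballE => /ball_sym. Qed.
Let rball_triangle x y z e1 e2 :
  rball x e1 y -> rball y e2 z -> rball x (e1 + e2) z.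
Proof. by rewrite !rballE scalar_of_realD; exact: ball_triangle. Qed.
Let rent : @entourage V' = entourage_ rball.
Proof.
apply/funext => E; rewrite /entourage_; apply/propext.
rewrite -[X in X <-> _]/(@entourage V E) -entourage_ballE.
split=> [[e /= e0 sE]|[e /= e0 sE]].
  exists (toR e); last first.
    by move=> p /=; rewrite rballE real_of_scalarK ?ltW//; apply: sE.
  by rewrite /= -(scalar_of_real_lt s) scalar_of_real0 real_of_scalarK// ltW.
exists (ofR e); last by move=> p /=; rewrite -rballE; apply: sE.
by rewrite /= -(scalar_of_real0 R s) scalar_of_real_lt.
Qed.

HB.instance Definition _ := Uniform_isPseudoMetric.Build R (realify V)
  rball_center rball_sym rball_triangle rent.
HB.instance Definition _ :=
  NormedZmod_PseudoMetric_eq.Build R (realify V) erefl.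

Let rnormZ (a : R) (x : realify V) : `|a *: x| = `|a| * `|x|.
Proof.
apply: (@scalar_of_real_inj R s); rewrite scalar_of_realM.
rewrite -norm_scalar_of_real -[LHS]/(ofR (rnorm _)) rnormE.
rewrite -[ofR `|x|]/(ofR (rnorm x)) rnormE.
exact: normrZ.
Qed.
HB.instance Definition _ :=
  PseudoMetricNormedZmod_Lmodule_isNormedModule.Build R (realify V) rnormZ.

Lemma realify_normE (x : V) : ofR `|x : realify V| = `|x|.
Proof. exact: rnormE. Qed.
End realify.

HB.instance Definition _ (R : realType) (s : scalar_kind)
  (V : completeNormedModType (scalar_field R s)) := Complete.on (realify V).

(** * Completeness of normed spaces *)

Definition complete_space (K : numFieldType) (V : normedModType K) :=
  forall F : set_system V, ProperFilter F -> cauchy F -> cvg F.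

(** The range of an operator is complete only under a hypothesis, which cannot
be found by instance resolution: the Banach structure is built on demand. *)
Definition banach_of (K : numFieldType) (V : normedModType K)
    (V_complete : complete_space V) : completeNormedModType K :=
  HB.pack (NormedModule.sort V) (Uniform_isComplete.Build _ V_complete).

Lemma prod_complete (K : numFieldType) (X Y : completeNormedModType K) :
  complete_space ((X * Y)%type : normedModType K).
Proof.
move=> F FF Fcauchy.
have Fc : cauchy_ex F by exact/cauchyP.
have c1 : cauchy (fst @ F).
  apply: (@cauchy_exP K) => e /Fc[p Fp]; exists p.1.
  by apply: (filterS _ Fp : F (fst @^-1` ball p.1 e)) => q /proj1.
have c2 : cauchy (snd @ F).
  apply: (@cauchy_exP K) => e /Fc[p Fp]; exists p.2.
  by apply: (filterS _ Fp : F (snd @^-1` ball p.2 e)) => q /proj2.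
have Fx := @cauchy_cvg _ _ (fmap_proper_filter _ FF) c1.
have Fy := @cauchy_cvg _ _ (fmap_proper_filter _ FF) c2.
suff : F --> (lim (fst @ F), lim (snd @ F)) by move/cvgP.
move=> A /(cvg_pair Fx Fy); rewrite !nbhs_simpl/=.
by move=> FA; apply: (filterS _ FA : F A) => -[].
Qed.

(** * Continuous selections of convex-valued maps *)

Section selection.
Variables (R : realType) (Z : pseudoMetricType R) (X : normedModType R).

(** A point value [sg z] is chosen for each [z] in a way that only jumps between
pieces lying at a positive distance of each other.  Well-order [X] and let
[sg z] be the least value lying in [Phi z'] for all [z'] near [z].  Let [D n]
be the set of those [z] for which [sg z] keeps this property on the whole ball
of radius [e n] around [z].  If [w] and [w'] of [D n] are at distance less than
[e n], then [sg w] competes for the minimum at [w'] and conversely, whence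
[sg w = sg w'].  This is the well-ordering argument of Stone's theorem that
metric spaces are paracompact. *)
Lemma selection_cover (Phi : Z -> set X) (O : set Z) :
    (forall z, O z -> exists x, \forall z' \near z, Phi z' x) ->
  exists (D : nat -> set Z) (sg : Z -> X) (e : nat -> R),
   [/\ forall n, 0 < e n, O `<=` \bigcup_n D n,
     (forall n w z, D n w -> ball w (e n) z -> Phi z (sg w)) &
     forall n w w', D n w -> D n w' -> ball w (e n) w' -> sg w = sg w'].
Proof.
move=> Phi_loc.
have [le le_wo] := well_ordering_principle X.
have le_anti : antisymmetric le.
  have /wo_chain_antisymmetric anti : wo_chain le predT by exact: withinW.
  by move=> x y /anti; exact.
pose stable (z : Z) : {pred X} := fun x => `[< \forall z' \near z, Phi z' x >].
have [sg sgP] : {sg : Z -> X &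
    forall z, O z -> minimum_of le (stable z) (sg z)}.
  apply: (@choice _ _ (fun z x => O z -> minimum_of le (stable z) x)) => z.
  have [Oz|nOz] := pselect (O z); last by exists 0.
  have [|x [xP _]] := le_wo (stable z); last by exists x.
  by have [x Px] := Phi_loc z Oz; exists x; apply/asboolP.
pose e n : R := n.+1%:R^-1.
pose D n := [set w | O w /\ forall z, ball w (e n) z -> sg w \in stable z].
exists D, sg, e; split.
- by move=> n; rewrite invr_gt0.
- move=> z Oz; have [/asboolP/nbhs_ballP[r /= r0 zrP] _] := sgP _ Oz.
  have r2 : 0 < r / 2 by rewrite divr_gt0.
  have [n nr] : exists n, e n < r / 2.
    have [N _ /(_ N (leqnn N))] := near_infty_natSinv_lt (PosNum r2).
    by exists N.
  exists n => //; split => // z' zz'; apply/asboolP/nbhs_ballP.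
  exists (r / 2); rewrite /= ?divr_gt0// => z'' z'z''; apply: zrP.
  rewrite [r]splitr; apply: ball_triangle z'z''.
  exact: le_ball (ltW nr) _ zz'.
- by move=> n w z [_ Dw] /Dw/asboolP/nbhs_singleton.
- move=> n w w' [Ow Dw] [Ow' Dw'] ww'; apply: le_anti.
  have [_ /(_ _ (Dw' _ (ball_sym ww'))) ->] := sgP _ Ow.
  by have [_ /(_ _ (Dw _ ww')) ->] := sgP _ Ow'.
Qed.

(** One piece of the selection: a weight [th], equal to one near [D] and
vanishing away from it, and a value [p] which on the support of [th] is locally
one of the constants [sg w].  Off that support [p] is arbitrary, so that only
[th] and the product are continuous. *)
Definition patch (D : set Z) (e : R) (sg : Z -> X) (th : Z -> R) (p : Z -> X) :=
  [/\ continuous th, continuous (fun z => th z *: p z),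
    forall z, 0 <= th z <= 1,
    forall z, th z != 0 -> exists2 w, D w & ball w e z /\ p z = sg w &
    forall w, D w -> \forall z \near w, th z = 1].

Lemma patch_exists (D : set Z) (e : R) (sg : Z -> X) : 0 < e ->
    (forall w w', D w -> D w' -> ball w e w' -> sg w = sg w') ->
  exists th p, patch D e sg th p.
Proof.
move=> e_gt0 Dsg; pose h := e / 8.
have h_gt0 : 0 < h by rewrite divr_gt0.
(* The radius e / 8 is small enough for two points of [D], each at distance
   less than 2 * h from a point of a common ball of radius h, to be at distance
   less than e. *)
have [th [th_cont th01 thQ thP]] : exists th : Z -> R, [/\ continuous th,
    forall z, 0 <= th z <= 1,
    forall z, th z != 0 -> exists2 w, D w & ball w (2 * h) z &
    forall w z, D w -> ball w h z -> th z = 1].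
  pose P := [set z | exists2 w, D w & ball w h z].
  pose Q := [set z | ~ exists2 w, D w & ball w (2 * h) z].
  have : uniform_separator Q P.
    apply: uniform_separatorW.
    exists [set q | ball q.1 h q.2].
      exact: (entourage_ball _ (PosNum h_gt0)).
    apply/seteqP; split=> // -[a b] [[/= Qa [w Dw wb]] ab]; apply: Qa.
    exists w => //; rewrite mulrDl mul1r.
    by apply: ball_triangle wb _; exact: ball_sym.
  move=> /(@uniform_separatorP _ R)[th [th_cont th01 thQ thP]].
  exists th; split=> //.
  - by move=> z; have := th01 (th z); apply; exists z.
  - move=> z /eqP thz; apply: contrapT => Qz.
    by apply: thz; apply: thQ; exists z.
  - by move=> w z Dw wz; apply: thP; exists z => //; exists w.
have [p pP] : {p : Z -> X & forall z,
    th z != 0 -> exists2 w, D w & ball w (2 * h) z /\ p z = sg w}.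
  apply: (@choice _ _ (fun z (x : X) =>
    th z != 0 -> exists2 w, D w & ball w (2 * h) z /\ x = sg w)) => z.
  have [thz0|nz] := pselect (th z = 0); first by exists 0; rewrite thz0 eqxx.
  have {}nz : th z != 0 by exact/eqP.
  by have [w Dw wz] := thQ z nz; exists (sg w) => _; exists w.
exists th, p; split=> //; last 2 first.
- move=> z /pP[w Dw [wz pw]]; exists w => //; split=> //.
  by apply: le_ball wz; rewrite /h; lra.
- move=> w Dw; apply/nbhs_ballP; exists h => // z; exact: thP.
have p_cst z z1 z2 : ball z h z1 -> ball z h z2 ->
    th z1 != 0 -> th z2 != 0 -> p z1 = p z2.
  move=> zz1 zz2 /pP[w1 Dw1 [wz1 ->]] /pP[w2 Dw2 [wz2 ->]].
  apply: Dsg Dw1 Dw2 _.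
  have := ball_triangle (ball_triangle wz1 (ball_sym zz1))
                        (ball_triangle zz2 (ball_sym wz2)).
  by apply: le_ball; rewrite /h; lra.
move=> z.
have near_h : \forall z' \near z, ball z h z' by apply/nbhs_ballP; exists h.
have [x xP] : exists x, forall z', ball z h z' -> th z' *: p z' = th z' *: x.
  have [[z0 [zz0 thz0]]|nz] := pselect (exists z0, ball z h z0 /\ th z0 != 0).
    exists (p z0) => z' zz'; have [->|nz'] := eqVneq (th z') 0.
      by rewrite !scale0r.
    by rewrite (p_cst z z' z0).
  exists 0 => z' zz'; have [->|nz'] := eqVneq (th z') 0.
    by rewrite !scale0r.
  by exfalso; apply: nz; exists z'.
rewrite /continuous_at xP; last exact: ballxx.
have thx : th z' *: x @[z' --> z] --> th z *: x.
  by apply: cvgZr_tmp; exact: th_cont.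
apply: cvg_trans thx; apply: near_eq_cvg.
by apply: filterS near_h => z' /xP ->.
Qed.

(** The patches of index [n], ..., [n + k - 1] are glued by nested convex
combinations; as soon as one of the weights met is one, the later patches no
longer matter.  This replaces a partition of unity: no infinite sum and no
division are involved. *)
Fixpoint glue (th : nat -> Z -> R) (p : nat -> Z -> X) (k n : nat)
    (z : Z) : X :=
  if k is k'.+1 then
    th n z *: p n z + (1 - th n z) *: glue th p k' n.+1 z
  else 0.

(** A selection theorem of Michael's type: a convex-valued map that has locally
constant selections has a continuous selection.  Each point of [O] has a
neighbourhood on which some weight is constantly one; there the gluing stops
after a fixed finite number of steps, hence is continuous. *)
Lemma convex_selection (Phi : Z -> set X) (O : set Z) :
    (forall z x y (t : R), Phi z x -> Phi z y -> 0 <= t <= 1 ->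
       Phi z (t *: x + (1 - t) *: y)) ->
    (forall z, O z -> exists x, \forall z' \near z, Phi z' x) ->
  exists f : Z -> X, forall z, O z -> Phi z (f z) /\ {for z, continuous f}.
Proof.
move=> Phi_convex /selection_cover[D [sg [e [e_gt0 Dcov DPhi Dsg]]]].
have [q qP] : {q : nat -> (Z -> R) * (Z -> X) &
    forall n, patch (D n) (e n) sg (q n).1 (q n).2}.
  apply: (@choice _ _ (fun n q => patch (D n) (e n) sg q.1 q.2)) => n.
  have [th [p ?]] := patch_exists (e_gt0 n) (Dsg n).
  by exists (th, p).
pose th n := (q n).1; pose p n := (q n).2.
pose F := glue th p.
have FS k n z : F k.+1 n z = th n z *: p n z + (1 - th n z) *: F k n.+1 z by [].
have F_cont k n : continuous (F k n).
  elim: k n => [|k IH] n z; first exact: cvg_cst.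
  have [th_cont thp_cont _ _ _] := qP n.
  apply: cvgD; first exact: thp_cont.
  apply: cvgZ; last exact: IH.
  by apply: cvgB; [exact: cvg_cst|exact: th_cont].
have F_stop N z k m n : th N z = 1 -> (n + m)%N = N ->
    F m.+1 n z = F (m + k).+1 n z.
  move=> thN; elim: m n => [|m IH] n nmN.
    by rewrite addn0 in nmN; rewrite nmN !FS thN subrr !scale0r.
  by rewrite addSn !(FS _.+1) IH// addSnnS.
have F_Phi N z m n : th N z = 1 -> (n + m)%N = N -> Phi z (F m.+1 n z).
  move=> thN; elim: m n => [|m IH] n nmN.
    have -> : n = N by rewrite -nmN addn0.
    rewrite FS thN subrr scale0r addr0 scale1r.
    have [_ _ _ + _] := qP N; rewrite -/(th N) => /(_ z).
    rewrite thN oner_eq0 => /(_ isT)[w Dw [wz pw]].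
    by rewrite /p pw; exact: DPhi wz.
  have FPhi : Phi z (F m.+1 n.+1 z) by apply: IH; rewrite addSnnS.
  rewrite FS; have [_ _ th01 + _] := qP n; rewrite -/(th n) => /(_ z).
  have [-> _|_ /(_ isT)[w Dw [wz pw]]] := eqVneq (th n z) 0.
    by rewrite scale0r add0r subr0 scale1r.
  apply: Phi_convex; [|exact: FPhi|exact: th01].
  by rewrite /p pw; exact: DPhi wz.
(* The number of steps may depend on z in any way: once a weight equal to one
   has been met, further steps do not change the value. *)
pose N z := xget 0 [set n | th n z = 1].
have NP z n : th n z = 1 -> th (N z) z = 1.
  by move=> thn; rewrite /N; case: xgetP => // /(_ n).
pose f z := F (N z).+1 0 z.
have fE z n : th n z = 1 -> f z = F n.+1 0 z.
  move=> thn; have thN := NP z n thn.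
  by rewrite /f (F_stop (N z) z n)// [RHS](F_stop n z (N z))// addnC.
exists f => z Oz; have [n _ Dnz] := Dcov z Oz.
have [_ _ _ _ /(_ z Dnz) thn1] := qP n.
have thnz := nbhs_singleton thn1; split.
  by rewrite (fE z n)//; exact: (F_Phi n).
suff : f @ z --> f z by [].
rewrite (fE z n)//.
apply: cvg_trans (F_cont n.+1 0 z); apply: near_eq_cvg.
by apply: filterS thn1 => z' /fE ->.
Qed.
End selection.

(** * Continuous right inverses of surjective operators *)

Lemma closed_subspaceP (K : numFieldType) (V : normedModType K) (D : set V) :
  closed_subspace D <->
  [/\ D 0, forall a u v, D u -> D v -> D (a *: u + v) & closed D].
Proof.
split=> [[[/set_mem D0 DS] Dc]|[D0 DS Dc]].
  split=> // a u v Du Dv; apply/set_mem; exact: DS (mem_set Du) (mem_set Dv).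
split=> //; split; first exact/mem_set.
by move=> a u v /set_mem Du /set_mem Dv; apply/mem_set; exact: DS.
Qed.

Lemma closed_subspaceT (K : numFieldType) (V : normedModType K) :
  closed_subspace [set: V].
Proof. by apply/closed_subspaceP; split=> //; exact: closedT. Qed.

(** The category half of the open mapping theorem: by Baire, the image of some
ball of [D] is dense in some ball of [Z], and by difference and homogeneity
every [z] is approximated up to a quarter of its norm by images of points of
size comparable to that of [z].  Stopping at a quarter leaves room for an error
of at most a half at the neighbouring points. *)
Lemma almost_open (R : realType) (X : normedModType R)
    (Z : completeNormedModType R) (T : {linear X -> Z}) (D : set X) :
    closed_subspace D -> (forall z, exists2 x, D x & T x = z) ->
  exists2 C : R, 0 < C &
    forall z, exists x, [/\ D x, `|x| <= C * `|z| & `|z - T x| <= `|z| / 4].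
Proof.
move=> /closed_subspaceP[D0 DS _] T_onto.
pose F n := closure [set T x | x in [set x | D x /\ `|x| <= n%:R]].
have [n ndense] : exists n, ~ dense (~` F n).
  apply: contrapT => /forallNP dense_F.
  have : dense (\bigcap_n ~` F n).
    apply: Baire => n; split; last by apply: contrapT; exact: dense_F.
    exact/closed_openC/closed_closure.
  move=> /(_ setT); case; [by exists 0|exact: openT|].
  move=> z [_ Fz]; have [x Dx Tx] := T_onto z.
  have [m xm] : exists m, `|x| <= m%:R.
    by exists (Num.bound `|x|); rewrite ltW// archi_boundP.
  by apply: (Fz m I); apply: subset_closure; exists x.
have [z0 [d d_gt0 Fd]] : exists z0, exists2 d : R, 0 < d & ball z0 d `<=` F n.
  move/existsNP: ndense => [U /not_implyP[[z0 Uz0] /not_implyP[oU UF]]].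
  have /nbhs_ballP[d /= d0 dU] : nbhs z0 U by exact: open_nbhs_nbhs.
  exists z0, d => // z /dU Uz; apply: contrapT => Fz; apply: UF.
  by exists z.
have approx z e : F n z -> 0 < e ->
    exists x, [/\ D x, `|x| <= n%:R & `|z - T x| < e].
  move=> Fz e0; have [_ [[x [Dx xn] <-]]] := Fz _ (nbhsx_ballx z e e0).
  by rewrite -ball_normE; exists x.
(* n.+1 instead of n, so that the constant is positive. *)
exists (4 * n.+1%:R / d); first by rewrite divr_gt0// mulr_gt0.
move=> z; have [->|z_neq0] := eqVneq z 0.
  by exists 0; rewrite linear0 subr0 !normr0 mulr0 mul0r.
have nz_gt0 : 0 < `|z| by rewrite normr_gt0.
(* z is scaled to t *: z, of norm d / 2, and t *: z is the difference of
   z0 + t *: z and z0, which both lie in the ball where approx applies. *)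
pose t := d / (2 * `|z|); have t_gt0 : 0 < t by rewrite divr_gt0// mulr_gt0.
have [x1 [Dx1 x1n zx1]] : exists x,
    [/\ D x, `|x| <= n%:R & `|z0 + t *: z - T x| < d / 16].
  apply: approx; last lra.
  apply: Fd; rewrite -ball_normE /ball_/= opprD addNKr normrN normrZ.
  rewrite gtr0_norm//.
  rewrite /t invfM mulrA divfK ?gt_eqF//; lra.
have [x2 [Dx2 x2n zx2]] : exists x,
    [/\ D x, `|x| <= n%:R & `|z0 - T x| < d / 16].
  apply: approx; last lra.
  by apply: Fd; exact: ballxx.
have tV_gt0 : 0 < t^-1 by rewrite invr_gt0.
have tVE : t^-1 = 2 * `|z| / d by rewrite invf_div.
exists (t^-1 *: (x1 - x2)); split.
- have Dx : D (x1 - x2) by have := DS (-1) _ _ Dx2 Dx1; rewrite scaleN1r addrC.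
  by have := DS t^-1 _ _ Dx D0; rewrite addr0.
- rewrite normrZ gtr0_norm// tVE.
  have -> : 4 * n.+1%:R / d * `|z| = 2 * `|z| / d * (2 * n.+1%:R) by ring.
  rewrite ler_pM2l -?tVE// (le_trans (ler_normB _ _))//.
  by rewrite mulr_natl mulr2n lerD// (le_trans x1n, le_trans x2n)// ler_nat.
- have -> : z - T (t^-1 *: (x1 - x2)) =
      t^-1 *: ((z0 + t *: z - T x1) - (z0 - T x2)).
    have -> : z0 + t *: z - T x1 - (z0 - T x2) = t *: z - (T x1 - T x2).
      by rewrite addrC -[z0 + _ - _]addrA opprB addrA subrK addrCA opprB.
    by rewrite linearZ linearB /= [RHS]scalerBr scalerK// gt_eqF.
  rewrite normrZ gtr0_norm// tVE.
  have -> : `|z| / 4 = 2 * `|z| / d * (d / 8).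
    by field; rewrite gt_eqF.
  rewrite ler_pM2l -?tVE// (le_trans (ler_normB _ _))//.
  lra.
Qed.

Lemma geometric_small (R : realType) (c e : R) : 0 < e ->
  exists n, c * 2^-1 ^+ n < e.
Proof.
move=> e0.
have /cvgrPdist_lt/(_ e e0)[n _ /(_ n (leqnn n))] :
    geometric c (2^-1) @ \oo --> (0 : R).
  by apply: cvg_geometric; rewrite ger0_norm ?invr_ge0//; lra.
by rewrite /= sub0r normrN => /(le_lt_trans (ler_norm _)); exists n.
Qed.

(** Correcting the residual again and again turns an approximate right inverse
[g] into an exact one: the residuals are halved at each step, so the series of
the corrections converges to some [G z] with [T (G z) = z].  The convergence is
uniform on bounded sets, hence [G] is continuous when [g] is.  The set [S] only
has to contain the successive residuals; it is the whole space when solving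
[T x = z], and the closure of the range when showing that the range is
closed. *)
Lemma successive_approximation (R : realType) (X : completeNormedModType R)
    (Z : normedModType R) (T : {linear X -> Z}) (D : set X) (S : set Z)
    (g : Z -> X) (C : R) :
    continuous T -> closed_subspace D -> 0 <= C ->
    (forall z, S z ->
      [/\ D (g z), `|g z| <= C * `|z|, `|z - T (g z)| <= `|z| / 2
        & S (z - T (g z))]) ->
  exists G : Z -> X,
    (forall z, S z -> [/\ D (G z), T (G z) = z & `|G z| <= 2 * C * `|z|]) /\
    (S = setT -> continuous g -> continuous G).
Proof.
move=> T_cont /closed_subspaceP[D0 DS D_closed] C0 gP.
pose res n (z : Z) := iter n (fun z => z - T (g z)) z.
pose s n (z : Z) := \sum_(k < n) g (res k z).
have sS n z : s n.+1 z = s n z + g (res n z) by rewrite /s big_ord_recr.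
have resP n z : S z -> S (res n z) /\ `|res n z| <= 2^-1 ^+ n * `|z|.
  move=> Sz; elim: n => [|n [Sn IH]]; first by rewrite expr0 mul1r.
  have [_ _ le_half] := gP _ Sn; split=> //=.
  by rewrite (le_trans le_half)// exprS; lra.
have Ts n z : T (s n z) = z - res n z.
  elim: n => [|n IH]; first by rewrite /s big_ord0 linear0 /= subrr.
  by rewrite sS linearD /= IH opprB addrA -[LHS]addrA [_ + T _]addrC addrA.
have Ds n z : S z -> D (s n z).
  move=> Sz; elim: n => [|n IH]; first by rewrite /s big_ord0.
  have [Dg _ _ _] := gP _ (resP n z Sz).1.
  by rewrite sS addrC -[g _]scale1r; exact: DS.
pose r n (z : Z) := 2 * C * `|z| * 2^-1 ^+ n.
have s_dist n m z : S z -> (n <= m)%N -> `|s m z - s n z| <= r n z - r m z.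
  move=> Sz /subnK <-; elim: (m - n)%N => [|k IH].
    by rewrite !subrr normr0.
  rewrite addSn sS addrAC (le_trans (ler_normD _ _))//.
  have [Sk resk] := resP (k + n)%N z Sz; have [_ gk _ _] := gP _ Sk.
  have := ler_wpM2l C0 resk; move: gk IH; rewrite /r exprS; lra.
have r_ge0 n z : 0 <= r n z by rewrite /r !mulr_ge0// exprn_ge0.
have s_dist_r n m z : S z -> (n <= m)%N -> `|s m z - s n z| <= r n z.
  by move=> Sz /(s_dist n m z Sz) /le_trans -> //; rewrite gerBl.
pose G (z : Z) := lim (s n z @[n --> \oo]).
have G_cvg z : S z -> s n z @[n --> \oo] --> G z.
  move=> Sz; apply: cauchy_cvg; apply: cauchy_exP => e e0.
  have [n rn] := geometric_small (2 * C * `|z|) e0.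
  exists (s n z), n => // m nm; rewrite -ball_normE /ball_/= distrC.
  exact: le_lt_trans (s_dist_r _ _ _ Sz nm) rn.
have G_dist n z : S z -> `|G z - s n z| <= r n z.
  move=> Sz; apply/ler_addgt0Pr => e e0.
  have /cvgrPdist_le/(_ e e0)[m _ mP] := G_cvg z Sz.
  have := mP _ (leq_maxl m n); have := s_dist_r n _ z Sz (leq_maxr m n).
  rewrite /=; have := ler_distD (s (maxn m n) z) (G z) (s n z); lra.
exists G; split=> [z Sz|ST g_cont z].
  split.
  - apply: (closed_cvg D D_closed _ (G z) (G_cvg z Sz)).
    by apply: nearW => n; exact: Ds.
  - have TG : T (s n z) @[n --> \oo] --> T (G z).
      by apply: cvg_comp; [exact: G_cvg|exact: T_cont].
    have Tz : T (s n z) @[n --> \oo] --> z.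
      apply/cvgrPdist_le => e e0.
      have [N rN] := geometric_small `|z| e0.
      exists N => // n /= Nn; rewrite Ts opprB addrC subrK.
      rewrite (le_trans (resP n z Sz).2)// (le_trans _ (ltW rN))// mulrC.
      by rewrite ler_wpM2l// ler_wiXn2l//; lra.
    by have := cvg_unique _ TG Tz; apply.
  - have := G_dist 0 z Sz; rewrite /s big_ord0 subr0 /r expr0; lra.
have res_cont n : continuous (res n).
  elim: n => [|n IH] x; first exact: cvg_id.
  apply: cvgB; first exact: IH.
  apply: cvg_comp; last exact: T_cont.
  by apply: cvg_comp; [exact: IH|exact: g_cont].
have s_cont n : continuous (s n).
  elim: n => [|n IH] x.
    have -> : s 0 = fun=> 0 by apply/funext => z'; rewrite /s big_ord0.
    exact: cvg_cst.
  have -> : s n.+1 = fun z' => s n z' + g (res n z').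
    by apply/funext => z'; exact: sS.
  apply: cvgD; first exact: IH.
  by apply: cvg_comp; [exact: res_cont|exact: g_cont].
apply/cvgrPdist_le => e e0.
have e3 : 0 < e / 3 by lra.
have [n rn] := geometric_small (2 * C * (`|z| + 1)) e3.
have small z' : `|z'| <= `|z| + 1 -> `|G z' - s n z'| <= e / 3.
  move=> z'z; rewrite (le_trans (G_dist n z' _)) ?ST// (le_trans _ (ltW rn))//.
  by rewrite /r ler_wpM2r ?exprn_ge0// ler_wpM2l// mulr_ge0.
near=> z'.
have z'z : `|z - z'| <= 1 by near: z'; exact: cvgr_dist_le.
have sz : `|s n z - s n z'| <= e / 3.
  near: z'; have /cvgrPdist_le := s_cont n z; exact.
have nz' : `|z'| <= `|z| + 1.
  by have := lerB_dist z' z; rewrite distrC; lra.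
have := small z' nz'; have := small z; rewrite lerDl ler01 => /(_ isT).
have := ler_distD (s n z) (G z) (G z').
have := ler_distD (s n z') (s n z) (G z').
rewrite [`|s n z' - G z'|]distrC; lra.
Unshelve. all: by end_near. Qed.

(** The open mapping theorem and the Bartle-Graves theorem at once.  By
[almost_open], the convex set [Phi z] of the bounded approximate solutions of
[T x = z] has, near each [z != 0], constant selections; a continuous selection
[g] of [Phi] is an approximate right inverse, which [successive_approximation]
makes exact. *)
Theorem continuous_right_inverse_real (R : realType)
    (X Z : completeNormedModType R) (T : {linear X -> Z}) (D : set X) :
    continuous T -> closed_subspace D -> (forall z, exists2 x, D x & T x = z) ->
  exists (G : Z -> X) (C : R), continuous G /\
    forall z, [/\ D (G z), T (G z) = z & `|G z| <= C * `|z|].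
Proof.
move=> T_cont D_closed T_onto.
have [C C0 TC] := almost_open D_closed T_onto.
have /closed_subspaceP[D0 DS _] := D_closed.
pose Phi (z : Z) :=
  [set x | [/\ D x, `|x| <= 2 * C * `|z| & `|z - T x| <= `|z| / 2]].
have Phi_convex z x y (t : R) : Phi z x -> Phi z y -> 0 <= t <= 1 ->
    Phi z (t *: x + (1 - t) *: y).
  move=> [Dx nx zx] [Dy ny zy] /andP[t0 t1].
  have t1' : 0 <= 1 - t by lra.
  have convex_norm (V : normedModType R) (u v : V) b :
      `|u| <= b -> `|v| <= b -> `|t *: u + (1 - t) *: v| <= b.
    move=> ub vb; rewrite (le_trans (ler_normD _ _))// !normrZ !ger0_norm//.
    have := ler_wpM2l t0 ub; have := ler_wpM2l t1' vb; lra.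
  split; [|exact: convex_norm|].
    by apply: (DS) => //; rewrite -[_ *: y]addr0; exact: DS.
  suff -> : z - T (t *: x + (1 - t) *: y) =
      t *: (z - T x) + (1 - t) *: (z - T y).
    exact: convex_norm.
  rewrite linearD !linearZ/= !scalerBr addrACA -opprD; congr (_ - _).
  by rewrite -scalerDl addrC subrK scale1r.
have Phi_loc z : z != 0 -> exists x, \forall z' \near z, Phi z' x.
  move=> z0; have nz0 : 0 < `|z| by rewrite normr_gt0.
  have [x [Dx nx zx]] := TC z; exists x.
  near=> z'.
  have zz' : `|z - z'| <= `|z| / 8 by near: z'; apply: cvgr_dist_le => //; lra.
  have h1 := ler_distD z z' (T x); rewrite [`|z' - z|]distrC in h1.
  have h2 := ler_normD (z - z') z'; rewrite subrK in h2.
  split=> //=; last by lra.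
  have : C * `|z| <= C * (2 * `|z'|) by apply: ler_wpM2l; [exact: ltW|lra].
  lra.
have [f fP] := convex_selection Phi_convex Phi_loc.
pose g z := if z == 0 then 0 else f z.
have gP z : Phi z (g z).
  rewrite /g; case: (eqVneq z 0) => [->|z0]; last exact: (fP z z0).1.
  split; [exact: D0|by rewrite !normr0 mulr0|].
  by rewrite linear0 subr0 normr0 mul0r.
have g_cont : continuous g.
  move=> z; have [z0|z0] := eqVneq z 0.
    have g0 : g z = 0 by rewrite /g z0 eqxx.
    (* At 0, continuity follows from the bound on g. *)
    rewrite /continuous_at g0; apply/cvgrPdist_le => e e0; rewrite z0.
    have eC : 0 < e / (2 * C) by rewrite divr_gt0// mulr_gt0.
    near=> z'.
    have z'e : `|z'| <= e / (2 * C).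
      by near: z'; apply: (@cvgr0_norm_le _ _ _ (nbhs (0 : Z)) _ id).
    have [_ gz' _] := gP z'; rewrite sub0r normrN (le_trans gz')//.
    by rewrite mulrC -ler_pdivlMr ?mulr_gt0.
  have := (fP z z0).2; rewrite /prop_for /continuous_at /g (negbTE z0).
  apply: cvg_trans; apply: near_eq_cvg.
  have : \forall z' \near z, z' != 0 by apply: cvgr_neq0 z0; exact: cvg_id.
  by apply: filterS => z' /negbTE ->.
have C20 : 0 <= 2 * C by rewrite mulr_ge0// ltW.
have [|G [GP GC]] :=
    @successive_approximation R X Z T D setT g _ T_cont D_closed C20.
  by move=> z _; have [Dg g_le g_approx] := gP z.
by exists G, (2 * (2 * C)); split=> [|z]; [exact: GC|exact: GP].
Unshelve. all: by end_near. Qed.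

(** * Right inverses and closed ranges over either field of scalars *)

Section scalars.
Variables (R : realType) (s : scalar_kind).
Local Notation K := (scalar_field R s).
Local Notation ofR := (@scalar_of_real R s).
Local Notation toR := (@real_of_scalar R s).

Lemma realify_linear (X Z : normedModType K) (T : {linear X -> Z}) :
  linear (T : realify X -> realify Z).
Proof. by move=> a u v; exact: (linearP T (ofR a)). Qed.

Definition real_linear (X Z : normedModType K) (T : {linear X -> Z}) :
    {linear realify X -> realify Z} :=
  HB.pack (T : realify X -> realify Z)
    (GRing.isLinear.Build R (realify X) (realify Z) *:%R T (realify_linear T)).

Lemma closed_subspace_real (X : normedModType K) (D : set X) :
  closed_subspace D -> closed_subspace (D : set (realify X)).
Proof.
move=> /closed_subspaceP[D0 DS Dc]; apply/closed_subspaceP; split=> // a.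
exact: DS.
Qed.

Theorem continuous_right_inverse (X Z : completeNormedModType K)
    (T : {linear X -> Z}) (D : set X) : continuous T ->
    closed_subspace D -> (forall z, exists2 x, D x & T x = z) ->
  exists (G : Z -> X) (C : K), continuous G /\
    forall z, [/\ D (G z), T (G z) = z & `|G z| <= C * `|z|].
Proof.
move=> T_cont D_closed T_onto.
pose X' : completeNormedModType R := realify X.
pose Z' : completeNormedModType R := realify Z.
have [G [C [G_cont GP]]] :=
  @continuous_right_inverse_real R X' Z' (real_linear T) D
    T_cont (closed_subspace_real D_closed) T_onto.
exists G, (ofR C); split; first exact: G_cont.
move=> z; have [DG TG nG] := GP z; split=> //.
rewrite -(realify_normE (G z : X)) -(realify_normE (z : Z)).
by rewrite -scalar_of_realM scalar_of_real_le.
Qed.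

(** If every point of the range has a preimage of comparable size, the range is
closed: a point of the closure is, up to half of its norm, the image of a point
of comparable size, and the residual is again in the closure. *)
Lemma closed_range_of_bound (X : completeNormedModType K) (Y : normedModType K)
    (T : {linear X -> Y}) (C : K) : continuous T ->
    (forall x, exists2 x', T x' = T x & `|x'| <= C * `|T x|) ->
  closed (range T).
Proof.
move=> T_cont TC.
pose X' : completeNormedModType R := realify X.
pose Y' : normedModType R := realify Y.
pose C' := toR `|C|.
have C'0 : 0 <= C'.
  by rewrite -(scalar_of_real_le s) scalar_of_real0 real_of_scalarK.
have TC' (x : X') : exists2 x' : X', T x' = T x & `|x'| <= C' * `|T x : Y'|.
  have [x' Tx' nx'] := TC x; exists x' => //.
  rewrite -(scalar_of_real_le s) scalar_of_realM real_of_scalarK//.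
  rewrite !realify_normE (le_trans nx')// -(ger0_norm (le_trans _ nx'))//.
  by rewrite normrM normr_id.
pose S : set Y' := closure (range T).
have S_approx (y : Y') (e : R) : S y -> 0 < e ->
    exists x : X', `|y - (T x : Y')| < e.
  move=> Sy e0; have [_ [[x _ <-]]] := Sy _ (nbhsx_ballx (y : Y') e e0).
  by rewrite -ball_normE; exists x.
have S_sub (y : Y') (x : X') : S y -> S (y - (T x : Y')).
  move=> Sy B /(@nbhs_ballP R Y')[e /= e0 Be].
  have [x' yx'] := S_approx y e Sy e0.
  exists (T (x' - x)); split; first by exists (x' - x).
  apply: Be; rewrite -ball_normE /ball_/= (linearB T x' x).
  by rewrite opprB addrA subrK.
have [g gP] : {g : Y' -> X' & forall y, S y ->
    `|g y| <= 2 * C' * `|y| /\ `|y - (T (g y) : Y')| <= `|y| / 2}.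
  apply: (@choice _ _ (fun (y : Y') (x : X') => S y ->
    `|x| <= 2 * C' * `|y| /\ `|y - (T x : Y')| <= `|y| / 2)) => y.
  have [Sy|nSy] := pselect (S y); last by exists 0.
  have [->|y0] := eqVneq y 0.
    by exists 0 => _; rewrite [T _](linear0 T) subr0 !normr0 mulr0 mul0r.
  have ny0 : 0 < `|y| / 2 by rewrite divr_gt0 ?normr_gt0.
  have [x yx] := S_approx y _ Sy ny0.
  have [x' Tx' nx'] := TC' x.
  exists x' => _; rewrite Tx'; split; last exact: ltW.
  have : C' * `|T x : Y'| <= C' * (2 * `|y|).
    apply: ler_wpM2l => //.
    by have := ler_normB y (y - (T x : Y')); rewrite subKr; lra.
  lra.
have [||G [GP _]] := @successive_approximation R X' Y' (real_linear T) setT S g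
    (2 * C') T_cont (@closed_subspaceT R X').
- by rewrite mulr_ge0.
- by move=> y Sy; have [? ?] := gP y Sy; split=> //; exact: S_sub.
by move=> y Sy; exists (G y) => //; have [] := GP y Sy.
Qed.

(** When [T] is injective on [D], its right inverse with values in [D] is
unique, hence linear.  The conclusion is not packed as a bounded map: in the
applications [X] or [Z] is a Banach space by virtue of a hypothesis, and the
bounded map is built afterwards between the underlying normed spaces. *)
Theorem bounded_linear_right_inverse (X Z : completeNormedModType K)
    (T : {linear X -> Z}) (D : set X) :
    continuous T -> closed_subspace D -> (forall z, exists2 x, D x & T x = z) ->
    (forall x, D x -> T x = 0 -> x = 0) ->
  exists G : Z -> X, [/\ linear G, exists C : K, forall z, `|G z| <= C * `|z|
    & forall z, D (G z) /\ T (G z) = z].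
Proof.
move=> T_cont D_closed T_onto T_inj.
have [G [C [_ GP]]] := continuous_right_inverse T_cont D_closed T_onto.
have /closed_subspaceP[D0 DS _] := D_closed.
exists G; split; last 2 first.
- by exists C => z; have [] := GP z.
- by move=> z; have [] := GP z.
move=> a u v; apply/subr0_eq/T_inj.
  have [Du _ _] := GP u; have [Dv _ _] := GP v.
  have [Duv _ _] := GP (a *: u + v).
  rewrite [X in D X]addrC -scaleN1r; apply: (DS) => //; exact: DS.
have [_ Tu _] := GP u; have [_ Tv _] := GP v.
have [_ Tuv _] := GP (a *: u + v).
by rewrite linearB linearP Tu Tv Tuv subrr.
Qed.

End scalars.

(** * Bounded maps, projections and the range space *)

Lemma bounded_map_ge0 (K : numFieldType) (V W : normedModType K)
    (f : 'L(V, W)) :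
  exists2 M : K, 0 <= M & forall v, `|f v| <= M * `|v|.
Proof.
have [M fM] : exists M : K, forall v, `|f v| <= M * `|v|.
  exact: bounded_map_subproof.
exists `|M| => // v; have := fM v.
by rewrite -{1}(ger0_norm (le_trans _ (fM v)))// normrM normr_id.
Qed.

Lemma bounded_map_continuous (K : numFieldType) (V W : normedModType K)
    (f : 'L(V, W)) : continuous f.
Proof.
have [M M0 fM] := bounded_map_ge0 f.
apply/linear_bounded_continuous/linear_boundedP; near=> r => v.
rewrite (le_trans (fM v))// ler_wpM2r//; near: r; apply: nbhs_pinfty_ge.
exact: ger0_real.
Unshelve. all: by end_near. Qed.

Definition bounded_map_of (K : numFieldType) (V W : normedModType K)
    (f : V -> W) (f_linear : linear f)
    (f_bounded : exists M : K, forall v, `|f v| <= M * `|v|) : 'L(V, W) :=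
  HB.pack f (GRing.isLinear.Build K V W *:%R f f_linear)
    (isBoundedMap.Build K V W f f_bounded).

(** For a bounded projection [P], the range is the kernel of [P - id], hence
closed, and [v = P v + (v - P v)] splits the space. *)
Lemma projection_complement (K : numFieldType) (V : normedModType K)
    (P : {linear V -> V}) : continuous P -> (forall v, P (P v) = P v) ->
  [/\ closed [set v | P v = v], complemented [set v | P v = 0]
    & complemented [set v | P v = v]].
Proof.
move=> P_cont PP.
have closed_eq0 (Q : {linear V -> V}) :
    continuous Q -> closed [set v | Q v = 0].
  move=> Q_cont; rewrite (_ : [set v | _] = Q @^-1` [set 0])//.
  apply: closed_comp => [v _|]; first exact: Q_cont.
  exact/accessible_closed_set1/hausdorff_accessible/norm_hausdorff.
have fixE : [set v | P v = v] = [set v | (P \- idfun) v = 0].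
  by apply/seteqP; split=> v /= => [->|/subr0_eq//]; rewrite subrr.
have fix_closed : closed [set v | P v = v].
  rewrite fixE; apply: (closed_eq0 (P \- idfun)) => v.
  by apply: cvgB; [exact: P_cont|exact: cvg_id].
have disjoint v : P v = 0 -> P v = v -> v = 0 by move=> ->.
split=> //.
- exists [set v | P v = v]; split.
  + apply/closed_subspaceP; split=> //; first by rewrite /= linear0.
    by move=> a u v /= Pu Pv; rewrite linearP Pu Pv.
  + move=> v; exists (v - P v), (P v); split; [|exact: PP|by rewrite subrK].
    by rewrite /= linearB PP subrr.
  + apply/seteqP; split=> [v [/=]|v ->]; first exact: disjoint.
    by split; rewrite /= linear0.
- exists [set v | P v = 0]; split.
  + apply/closed_subspaceP; split; [by rewrite /= linear0| |exact: closed_eq0].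
    by move=> a u v /= Pu Pv; rewrite linearP Pu Pv scaler0 addr0.
  + move=> v; exists (P v), (v - P v).
    split; [exact: PP| |by rewrite addrC subrK].
    by rewrite /= linearB PP subrr.
  + apply/seteqP; split=> [v [/= Pv P0]|v ->]; first exact: disjoint.
    by split; rewrite /= linear0.
Qed.

Section range_space.
Variables (K : numFieldType) (X Y : normedModType K) (A : 'L(X, Y)).

Lemma corestr_linear : linear (corestr A).
Proof. by move=> a u v; apply/val_inj; exact: linearP. Qed.

HB.instance Definition _ :=
  GRing.isLinear.Build K X (range_space A) *:%R (corestr A) corestr_linear.

Lemma corestr_continuous : continuous (corestr A).
Proof.
move=> x; apply/cvgrPdist_le => e e0.
have /cvgrPdist_le/(_ e e0) := bounded_map_continuous (f := A) (x := x).
exact.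
Qed.

Lemma corestr_surjective (z : range_space A) : exists x, corestr A x = z.
Proof.
have /set_mem[x _ Ax] : val z \in range A := valP z.
by exists x; apply/val_inj.
Qed.

End range_space.

Lemma range_complete (K : numFieldType) (X : normedModType K)
    (Y : completeNormedModType K) (A : 'L(X, Y)) :
  closed (range A) -> complete_space (range_space A).
Proof.
move=> A_closed F FF Fcauchy.
have Fc : cauchy_ex F by exact/cauchyP.
have c1 : cauchy (val @ F).
  apply: (@cauchy_exP K) => e /Fc[p Fp]; exists (val p).
  apply: (filterS _ Fp : F (val @^-1` ball (val p) e)) => q.
  by rewrite -!ball_normE.
have Fy := @cauchy_cvg _ _ (fmap_proper_filter _ FF) c1.
have y_range : range A (lim (val @ F)).
  apply: (closed_cvg _ A_closed _ _ Fy).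
  by apply: nearW => z; exact/set_mem/(valP z).
suff : F --> (Sub (lim (val @ F)) (mem_set y_range) : range_space A).
  by move/cvgP.
apply/cvgrPdist_lt => e e0.
have /cvgrPdist_lt/(_ e e0) := Fy; exact.
Qed.

(** * Characterizations of well-posedness *)

Section well_posedness.
Variables (R : realType) (s : scalar_kind).
Local Notation K := (scalar_field R s).
Local Notation ofR := (@scalar_of_real R s).
Local Notation toR := (@real_of_scalar R s).

Lemma quot_norm_coset_le (X Y : normedModType K) (A : 'L(X, Y)) (x : X) :
  `|coset A x| <= `|x|.
Proof.
rewrite -[`|x|](@real_of_scalarK R s)//.
rewrite -[`|coset A x|]/(ofR (inf (class_norms (coset A x)))) scalar_of_real_le.
apply: ge_inf; last by exists x.
exists 0 => _ [y _ <-].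
by rewrite -(scalar_of_real_le s) scalar_of_real0 real_of_scalarK.
Qed.

Lemma quot_norm_lt_ex (X Y : normedModType K) (A : 'L(X, Y))
    (q : quot_null A) (c : K) : `|q| < c -> exists2 x, coset A x = q & `|x| < c.
Proof.
move=> qc; have c0 : 0 <= c by rewrite ltW// (le_lt_trans _ qc).
move: qc; rewrite -(real_of_scalarK c0) -[`|q|]/(ofR (inf (class_norms q))).
rewrite scalar_of_real_lt => /inf_lt[|_ [x xq <-]].
  by exists (toR `|(repr q : X)|); exists (repr q) => //; exact: cosetK.
rewrite -(scalar_of_real_lt s) !real_of_scalarK// => xc.
by exists x.
Qed.

Variables (X Y : completeNormedModType K) (A : 'L(X, Y)).

Let A_cont : continuous A := bounded_map_continuous (f := A).

Lemma HaWP_iff : HaWP A <-> exists B : 'L(Y, X),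
  (forall x, B (A x) = x) /\ (forall y, A (B y) = y).
Proof.
split=> [[A_onto A_inj]|[B [BA AB]]].
  have inj x : A x = 0 -> x = 0.
    by move=> Ax0; have : null_space A x by []; rewrite A_inj.
  have [||B [B_lin B_bnd BP]] :=
      bounded_linear_right_inverse A_cont (@closed_subspaceT _ X).
  - move=> y; have : range A y by rewrite A_onto.
    by case=> x _ <-; exists x.
  - by move=> x _; exact: inj.
  exists (bounded_map_of B_lin B_bnd); split=> [x|y]; last by have [] := BP y.
  apply/subr0_eq/inj; rewrite linearB; have [_ /= ->] := BP (A x).
  by rewrite subrr.
split; apply/seteqP; split=> //.
- by move=> y _; exists (B y).
- by move=> x Ax0; rewrite /= -(BA x) Ax0 linear0.
- by move=> x ->; exact: linear0.
Qed.

Lemma corestr_continuous_right_inverse : closed (range A) ->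
  exists (G : range_space A -> X) (C : K), continuous G /\
    forall z, corestr A (G z) = z /\ `|G z| <= C * `|z|.
Proof.
move=> A_closed; pose Z := banach_of (range_complete A_closed).
pose T : {linear X -> Z} :=
  HB.pack (corestr A : X -> Z)
    (GRing.isLinear.Build K X Z *:%R (corestr A) (corestr_linear A)).
have [|||G [C [G_cont GP]]] := @continuous_right_inverse R s X Z T setT.
- exact: (corestr_continuous (A := A)).
- exact: closed_subspaceT.
- by move=> z; have [x Ax] := corestr_surjective (A := A) z; exists x.
by exists G, C; split=> // z; have [_ TG nG] := GP z.
Qed.

(** Solving for unknowns in [D] makes the inverse linear and bounded at once;
projecting onto [D] some right inverse with values in [X] would require the
boundedness of that projection. *)
Lemma corestr_right_inverse (D : set X) :
    closed (range A) -> closed_subspace D ->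
    (forall x, exists2 u, D u & A u = A x) ->
    (forall x, D x -> A x = 0 -> x = 0) ->
  exists B : 'L(range_space A, X), forall z, D (B z) /\ corestr A (B z) = z.
Proof.
move=> A_closed D_closed D_onto D_inj.
pose Z := banach_of (range_complete A_closed).
pose T : {linear X -> Z} :=
  HB.pack (corestr A : X -> Z)
    (GRing.isLinear.Build K X Z *:%R (corestr A) (corestr_linear A)).
have [||||B [B_lin B_bnd BP]] := @bounded_linear_right_inverse R s X Z T D.
- exact: (corestr_continuous (A := A)).
- exact: D_closed.
- move=> z; have [x <-] := corestr_surjective (A := A) z.
  by have [u Du Au] := D_onto x; exists u => //; exact/val_inj.
- by move=> x Dx /(congr1 val); exact: D_inj.
exists (@bounded_map_of K (range_space A) X B B_lin B_bnd) => z.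
exact: BP.
Qed.

Lemma closed_range_of_corestr (B : 'L(range_space A, X)) :
  (forall x, A (B (corestr A x)) = A x) -> closed (range A).
Proof.
move=> ABA; have [M M0 BM] := bounded_map_ge0 B.
apply: (closed_range_of_bound (C := M) A_cont) => x.
by exists (B (corestr A x)); [exact: ABA|exact: BM].
Qed.

Lemma HSWP_iff : HSWP A <-> exists B : 'L(range_space A, X),
  forall x, B (corestr A x) = x.
Proof.
split=> [[A_closed A_inj]|[B BA]].
  have inj x : A x = 0 -> x = 0.
    by move=> Ax0; have : null_space A x by []; rewrite A_inj.
  have [||B BP] := corestr_right_inverse A_closed (@closed_subspaceT _ X).
  - by move=> x; exists x.
  - by move=> x _; exact: inj.
  exists B => x; apply/subr0_eq/inj; rewrite linearB.
  by have [_ /(congr1 val) /= ->] := BP (corestr A x); rewrite subrr.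
split.
  by apply: (closed_range_of_corestr (B := B)) => x; rewrite BA.
apply/seteqP; split=> x; last by move=> ->; exact: linear0.
move=> Ax0; have -> : x = B (corestr A 0).
  by rewrite -(BA x); congr (B _); apply/val_inj; rewrite /= linear0.
exact: BA.
Qed.

(** If [U] complements the null space, [A] maps [U] bijectively onto its range,
and the inverse of this bijection is bounded.  Conversely, [B A] is a bounded
projection with the null space of [A] as kernel. *)
Lemma WP_iff : WP A <-> exists B : 'L(range_space A, X),
  forall x, A (B (corestr A x)) = A x.
Proof.
split=> [[A_closed [U [U_closed U_sum U_disj]]]|[B ABA]].
  have [||B BP] := corestr_right_inverse A_closed U_closed.
  - move=> x; have [n [u [Nn Uu ->]]] := U_sum x; exists u => //.
    by rewrite linearD [X in _ = X + _]Nn add0r.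
  - move=> x Ux Ax0; have : (null_space A `&` U) x by [].
    by rewrite U_disj.
  by exists B => x; have [_ /(congr1 val)] := BP (corestr A x).
split; first exact: closed_range_of_corestr ABA.
pose P : {linear X -> X} := B \o corestr A.
have P_cont : continuous P.
  move=> x; apply: cvg_comp; first exact: (corestr_continuous (A := A)).
  exact: (bounded_map_continuous (f := B)).
have [|_ + _] := projection_complement P_cont.
  by move=> x; congr (B _); apply/val_inj; exact: ABA.
rewrite (_ : [set v | P v = 0] = null_space A)//.
apply/seteqP; split=> x => [Px0|Ax0].
  by rewrite /null_space/= -ABA [B _]Px0 linear0.
rewrite /= (_ : corestr A x = 0) ?linear0//.
by apply/val_inj.
Qed.

(** If [U] and [V] complement the null space and the range, [(u, v) |-> A u + v]
is a bijection from the product of [U] and [V] onto [Y]; the first component of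
its inverse is [B].  Conversely, [B A] and [A B] are bounded projections, with
the null space of [A] as kernel and the range of [A] as image respectively. *)
Lemma NVWP_iff : NVWP A <-> exists B : 'L(Y, X), forall x, A (B (A x)) = A x.
Proof.
split=> [[A_closed [U [U_closed U_sum U_disj]]
           [V [V_closed V_sum V_disj]]]|[B ABA]].
  pose W := banach_of (@prod_complete K X Y).
  pose T (w : W) : Y := A w.1 + w.2.
  have T_lin : linear T.
    by move=> a u v; rewrite /T /= linearP scalerDr addrACA.
  pose T' : {linear W -> Y} :=
    HB.pack T (GRing.isLinear.Build K W Y *:%R T T_lin).
  pose D : set W := [set w | U w.1 /\ V w.2].
  have /closed_subspaceP[U0 US Uc] := U_closed.
  have /closed_subspaceP[V0 VS Vc] := V_closed.
  have [||||G [G_lin [C GC] GP]] :=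
      @bounded_linear_right_inverse R s W Y T' D.
  - move=> w; apply: cvgD; last exact: cvg_snd.
    by apply: cvg_comp; [exact: cvg_fst|exact: A_cont].
  - apply/closed_subspaceP; split=> //.
    + by move=> a u v [Uu Vu] [Uv Vv]; split; [exact: US|exact: VS].
    + apply: closedI.
        by apply: closed_comp => // w _; exact: cvg_fst.
      by apply: closed_comp => // w _; exact: cvg_snd.
  - move=> y; have [_ [v [[x _ <-] Vv ->]]] := V_sum y.
    have [n [u [Nn Uu ->]]] := U_sum x; exists (u, v) => //.
    by rewrite /= /T/= linearD [X in X + _ + _]Nn add0r.
  - move=> [u v] [/= Uu Vv] /eqP; rewrite /T /= addr_eq0 => /eqP Auv.
    have v0 : v = 0.
      suff : (range A `&` V) v by rewrite V_disj.
      split=> //; exists (- u) => //.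
      by rewrite -[RHS]opprK -Auv; exact: linearN.
    have u0 : u = 0.
      suff : (null_space A `&` U) u by rewrite U_disj.
      by split=> //; rewrite /null_space /= Auv v0 oppr0.
    by rewrite u0 v0.
  have B_lin : linear (fun y => (G y).1 : X) by move=> a u v; rewrite G_lin.
  have B_bnd : exists C : K, forall y, `|(G y).1 : X| <= C * `|y|.
    exists C => y; apply: le_trans (GC y).
    suff fst_le (w : (X * Y)%type) : `|w.1| <= `|w| by exact: fst_le.
    by rewrite num_le_max /= lexx.
  exists (bounded_map_of B_lin B_bnd) => x /=.
  have [[Uu Vv] TG] := GP (A x).
  suff v0 : (G (A x)).2 = 0 by rewrite -[RHS]TG /= /T v0 addr0.
  suff : (range A `&` V) (G (A x)).2 by rewrite V_disj.
  split=> //; exists (x - (G (A x)).1) => //.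
  by rewrite linearB -[X in X - _ = _]TG /= /T addrAC subrr add0r.
have B_cont : continuous B := bounded_map_continuous (f := B).
pose P : {linear X -> X} := B \o A; pose Q : {linear Y -> Y} := A \o B.
have P_cont : continuous P.
  by move=> x; apply: cvg_comp; [exact: A_cont|exact: B_cont].
have Q_cont : continuous Q.
  by move=> x; apply: cvg_comp; [exact: B_cont|exact: A_cont].
have [|_ N_compl _] := projection_complement P_cont.
  by move=> x; rewrite /= ABA.
have [|R_closed _ R_compl] := projection_complement Q_cont.
  by move=> x; rewrite /= ABA.
have NE : [set v | P v = 0] = null_space A.
  apply/seteqP; split=> x => [/= Px0|Ax0].
    by rewrite /null_space/= -ABA Px0 linear0.
  by rewrite /= [A x]Ax0 linear0.
have RE : [set y | Q y = y] = range A.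
  by apply/seteqP; split=> [y /= <-|_ [x _ <-]]; [exists (B y)|exact: ABA].
by rewrite NE in N_compl; rewrite RE in R_closed R_compl.
Qed.

(** Conversely to the Bartle-Graves theorem, the continuous maps [A B] and the
identity agree on the range of [A], hence on its closure. *)
Lemma RWP_continuous_iff : RWP A <-> exists B : Y -> X,
  {within closure (range A), continuous B} /\ (forall x, A (B (A x)) = A x).
Proof.
split=> [A_closed|[B [B_cont ABA]]].
  have [G [C [G_cont GP]]] := corestr_continuous_right_inverse A_closed.
  pose B (y : Y) : X := oapp G 0 (insub y : option (range_space A)).
  have BE (z : range_space A) : B (val z) = G z by rewrite /B valK.
  exists B; split; last first.
    move=> x; rewrite -[X in B X]/(val (corestr A x)) BE.
    by have [/(congr1 val)] := GP (corestr A x).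
  rewrite -(proj1 (closure_id _) A_closed).
  apply/subspace_continuousP => y /mem_set Ay.
  pose z : range_space A := Sub y Ay.
  suff : B y' @[y' --> within (range A) (nbhs y)] --> B (val z) by [].
  rewrite BE; apply/cvgrPdist_lt => e e0.
  have /cvgrPdist_lt/(_ e e0) := G_cont z.
  rewrite !near_simpl => /nbhs_ballP[d /= d0 zd].
  apply/nbhs_ballP; exists d => // y' yy' /mem_set Ay'.
  have -> : B y' = G (Sub y' Ay') by exact: (BE (Sub y' Ay')).
  by apply: zd; move: yy'; rewrite -!ball_normE.
move=> y Ay; suff <- : A (B y) = y by exists (B y).
have /subspace_continuousP/(_ y Ay) By := B_cont.
apply: contrapT => ABy_neq; pose e := `|A (B y) - y|.
have e0 : 0 < e by rewrite normr_gt0 subr_eq0; apply/eqP.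
have ABy : A (B y') @[y' --> within (closure (range A)) (nbhs y)] --> A (B y).
  by apply: cvg_comp; [exact: By|exact: A_cont].
have e2 : 0 < e / 2 by rewrite divr_gt0.
have /cvgrPdist_lt/(_ _ e2) near_ABy := ABy.
have [_ [[x _ <-] [ABx Axy]]] :=
  Ay _ (filterI (F := nbhs y) near_ABy (nbhsx_ballx y _ e2)).
have /ABx : closure (range A) (A x) by apply: subset_closure; exists x.
move: Axy; rewrite -ball_normE /= => yAx; rewrite ABA => ByAx.
have := ler_distD (A x) (A (B y)) y; rewrite [`|A x - y|]distrC -/e.
by move=> /le_lt_trans /(_ (ltrD ByAx yAx)); rewrite -splitr ltxx.
Qed.

(** The right inverse given by the open mapping theorem need not be linear, but
its class modulo the null space is determined, hence linear and bounded.
Conversely, a bound on the inverse of the quotient map bounds the norm of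
suitable representatives. *)
Lemma RWP_quotient_iff : RWP A <-> exists C : 'L(range_space A, quot_null A),
  cancel (Atilde A) C /\ cancel C (Atilde A).
Proof.
split=> [A_closed|[C [AC CA]]].
  have [G [M [_ GP]]] := corestr_continuous_right_inverse A_closed.
  have AG z : A (G z) = val z by have [/(congr1 val)] := GP z.
  pose C z := coset A (G z).
  have C_lin : linear C.
    move=> a u v; rewrite /C -cosetZ -cosetD; apply/coset_eqP.
    rewrite AG [LHS](_ : _ = a *: val u + val v)//.
    by rewrite -(AG u) -(AG v); exact/esym/linearP.
  have C_bnd : exists M : K, forall z, `|C z| <= M * `|z|.
    exists M => z; have [_ nG] := GP z.
    exact: le_trans (quot_norm_coset_le _ _) nG.
  exists (bounded_map_of C_lin C_bnd); split=> [q|z] /=.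
    rewrite /C -[q in RHS](@cosetK _ _ _ _ A q); apply/coset_eqP.
    by rewrite AG.
  by rewrite /C Atilde_coset; apply/val_inj; rewrite /= AG.
have [M M0 CM] := bounded_map_ge0 C.
(* M + 1 instead of M: the infimum defining the quotient norm need not be
   attained. *)
apply: (closed_range_of_bound (C := M + 1) A_cont) => x.
have [Ax0|Ax0] := eqVneq (A x) 0.
  exists 0; first exact: etrans (linear0 A) (esym Ax0).
  by rewrite normr0 mulr_ge0// addr_ge0.
have : `|C (corestr A x)| < (M + 1) * `|A x|.
  rewrite (le_lt_trans (CM _))// mulrDl mul1r ltrDl normr_gt0//.
move=> /quot_norm_lt_ex[x' Cx' nx']; exists x'; last exact: ltW.
by have := CA (corestr A x); rewrite -Cx' Atilde_coset => /(congr1 val).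
Qed.

End well_posedness.

Theorem theorem1 (R : realType) (s : scalar_kind)
    (X Y : completeNormedModType (scalar_field R s)) (A : 'L(X, Y)) :
  (HaWP A <-> exists B : 'L(Y, X),
     (forall x, B (A x) = x) /\ (forall y, A (B y) = y)) /\
  (HSWP A <-> exists B : 'L(range_space A, X),
     forall x, B (corestr A x) = x) /\
  (NVWP A <-> exists B : 'L(Y, X), forall x, A (B (A x)) = A x) /\
  (WP A <-> exists B : 'L(range_space A, X),
     forall x, A (B (corestr A x)) = A x) /\
  (RWP A <-> exists B : Y -> X,
     {within closure (range A), continuous B} /\
     (forall x, A (B (A x)) = A x)) /\
  (RWP A <-> exists C : 'L(range_space A, quot_null A),
     cancel (Atilde A) C /\ cancel C (Atilde A)).
Proof.
split; first exact: HaWP_iff.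
split; first exact: HSWP_iff.
split; first exact: NVWP_iff.
split; first exact: WP_iff.
by split; [exact: RWP_continuous_iff|exact: RWP_quotient_iff].
Qed.
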